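(* Let $s=s(n)\ge n$ be an integer. If each edge of $K_{n,n}$ is given one of $s$ colors independently and uniformly at random, then with probability tending to $1$ as $n\to\infty$ the resulting edge-colored $K_{n,n}$ has a rainbow perfect matching.
   Context: $K_{n,n}$ is the complete bipartite graph with $n$ vertices in each part. A perfect matching of an edge-colored $K_{n,n}$ is rainbow if no two of its edges have the same color. The coloring described is the paper's uniform random model $\mathsf{URM}$ with $s$ colors. *)

(* Defs.v *)
(* MathComp / MathComp-Analysis. *)
From HB Require Import structures.
From mathcomp Require Import all_boot all_order all_algebra.
From mathcomp Require Import all_classical all_reals all_analysis.

Set Implicit Arguments.
Unset Strict Implicit.
Unset Printing Implicit Defensive.

Import Order.TTheory GRing.Theory Num.Theory.
Local Open Scope ring_scope.

(* The vertices of K_{n,n} are tagged by their part; the edge joining [inl i]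
   to [inr j] is encoded as the pair [(i, j)], so every pair is an edge. *)
Definition vertex (n : nat) : finType := ('I_n + 'I_n)%type.
Definition edge (n : nat) : finType := ('I_n * 'I_n)%type.

Definition incident (n : nat) (v : vertex n) (e : edge n) : bool :=
  match v with
  | inl i => e.1 == i
  | inr j => e.2 == j
  end.

Definition perfect_matching (n : nat) (M : {set edge n}) : bool :=
  [forall v : vertex n, #|[set e in M | incident v e]| == 1%N].

(* Colorings are arbitrary, not necessarily proper. *)
Definition coloring (n s : nat) : finType := {ffun edge n -> 'I_s}.

Definition rainbow (n s : nat) (c : coloring n s) (M : {set edge n}) : bool :=
  [forall e in M, forall f in M, (e != f) ==> (c e != c f)].

Definition has_rainbow_perfect_matching (n s : nat) (c : coloring n s) : bool :=
  [exists M : {set edge n}, perfect_matching M && rainbow c M].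

Definition uniform_color (R : realType) (s : nat) (k : 'I_s) : R := s%:R^-1.

(* By independence, a coloring has probability the product over all edges of
   the probability of the color that the edge receives. *)
Definition URM (R : realType) (n s : nat) (A : {set coloring n s}) : R :=
  \sum_(c in A) \prod_(e : edge n) uniform_color R (c e).

(* Main.v *)
(* Second moment method. Let X count the permutations u of 'I_n whose graph
   {(i, u i)} is rainbow. A single graph is rainbow with probability
   p = (s)_n / s^n, (s)_k being the falling factorial. Given that the graph of u
   is rainbow, recoloring one by one the n - k edges that the graph of v does
   not share with it shows that both are rainbow with probability p^2 g(k),
   where g(k) = s^k / (s)_k. Hence E[X^2] / E[X]^2 is the mean of g(number of
   fixed points) over a uniform permutation. At least j points are fixed with
   probability at most 1/j!, and g(j + 1) - g(j) = g(j + 1) j / s, so summation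
   by parts bounds this mean by
     1 + (1/s) \sum_j g(j + 1) j / (j + 1)!.
   For j <= s, g(j) <= j^j / j! <= e^j, so the mean is 1 + O(1/n) uniformly
   in s >= n, and Chebyshev's inequality gives P(X = 0) = O(1/n). *)
Require Import Defs.
From HB Require Import structures.
From mathcomp Require Import all_boot all_order all_algebra all_fingroup.
From mathcomp Require Import all_classical all_reals all_analysis.
From mathcomp Require Import ring lra.
Import Order.TTheory GRing.Theory Num.Theory.
Import numFieldNormedType.Exports.
Local Open Scope ring_scope.

(** * Recoloring and the count of colorings that are injective on a set *)

Definition recolor {E C : finType} (c : {ffun E -> C}) (e : E) (x : C) :
  {ffun E -> C} := [ffun y => if y == e then x else c y].

Lemma dinjectiveb_recolor {E C : finType} (c : {ffun E -> C}) (e : E) (x : C)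
    (D : {set E}) : e \notin D ->
  dinjectiveb (recolor c e x) D = dinjectiveb c D.
Proof.
move=> eD; have sub y : y \in D -> recolor c e x y = c y.
  by move=> yD; rewrite ffunE ifN//; apply: contraNneq eD => <-.
by apply/dinjectiveP/dinjectiveP => inj y z yD zD; move: (inj y z yD zD);
  rewrite !sub.
Qed.

Lemma dinjectiveb_recolorU1 {E C : finType} (c : {ffun E -> C}) (e : E) (x : C)
    (D : {set E}) : e \notin D -> dinjectiveb c D ->
  dinjectiveb (recolor c e x) (e |: D) = (x \notin [set c y | y in D]).
Proof.
move=> eD /dinjectiveP injD; have sub y : y \in D -> recolor c e x y = c y.
  by move=> yD; rewrite ffunE ifN//; apply: contraNneq eD => <-.
have sube : recolor c e x e = x by rewrite ffunE eqxx.
apply/dinjectiveP/idP => [inj|nx y z].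
  apply/negP => /imsetP[y yD xy].
  have : recolor c e x e = recolor c e x y by rewrite sube sub.
  move=> /(inj _ _ (setU11 _ _) (setU1r _ yD)) ey.
  by rewrite ey yD in eD.
move=> /setU1P[->|yD] /setU1P[->|zD] //.
- by rewrite sube sub// => xz; move: nx; rewrite xz imset_f.
- by rewrite sube sub// => xz; move: nx; rewrite -xz imset_f.
- by rewrite !sub//; exact: injD.
Qed.

(* Double counting: (c, x) |-> (recolor c e x, c e) is an involution. *)
Lemma card_dinjectiveU1 {E C : finType} (Q : pred {ffun E -> C}) (D : {set E})
    (e : E) : e \notin D ->
  (forall c x, Q (recolor c e x) = Q c) -> (forall c, Q c -> dinjectiveb c D) ->
  (#|[pred c | Q c && dinjectiveb c (e |: D)]| * #|C| =
     #|Q| * (#|C| - #|D|))%N.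
Proof.
move=> eD Qe QD; set P := [pred c | _].
pose h (p : {ffun E -> C} * C) := (recolor p.1 e p.2, p.1 e).
have hK : involutive h.
  move=> [c x]; rewrite /h/= ffunE eqxx; congr pair; apply/ffunP => y.
  by rewrite !ffunE; case: eqP => // ->.
have -> : (#|P| * #|C| = \sum_(p : {ffun E -> C} * C) P p.1)%N.
  rewrite -(pair_bigA _ (fun c (_ : C) => nat_of_bool (P c)))/=.
  under eq_bigr do rewrite sum_nat_const.
  by rewrite -big_distrr/= mulnC -(sum1_card P) [in LHS]big_mkcond.
rewrite (reindex_inj (inv_inj hK))/=.
rewrite -(pair_bigA _ (fun c x => nat_of_bool (P (recolor c e x))))/=.
rewrite -(sum1_card Q) big_distrl/= [RHS]big_mkcond/=; apply: eq_bigr => c _.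
rewrite -[c \in Q]/(Q c); case: ifPn => [Qc|/negbTE Qc]; last first.
  by rewrite big1// => x _; rewrite Qe Qc.
under eq_bigr do rewrite Qe Qc dinjectiveb_recolorU1 ?QD//=.
rewrite mul1n -(card_in_imset (dinjectiveP _ _ (QD c Qc))) -[X in (X - _)%N]cardsT.
rewrite -cardsDS ?subsetT// finset.setTD -sum1_card [RHS]big_mkcond/=.
by apply: eq_bigr => x _; rewrite inE; case: (_ \notin _).
Qed.

(** Given [Q], the set [B] already occupies [#|B|] colors, and [Q] says nothing about the colors on
    [A]. Coloring [A] one element at a time leaves [#|C| - #|B|] good choices, then one fewer each
    time; the product is the falling factorial. *)
Lemma card_dinjectiveU {E C : finType} (Q : pred {ffun E -> C}) (A B : {set E}) :
  [disjoint A & B] ->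
  (forall e c x, e \in A -> Q (recolor c e x) = Q c) ->
  (forall c, Q c -> dinjectiveb c B) ->
  (#|[pred c | Q c && dinjectiveb c (A :|: B)]| * #|C| ^ #|A| =
     #|Q| * (#|C| - #|B|) ^_ #|A|)%N.
Proof.
move: {2}#|A| (erefl #|A|) => m; elim: m A => [|m IHm] A cA dAB QA QB.
  rewrite cA expn0 ffactn0 !muln1; move/eqP: cA; rewrite cards_eq0 => /eqP ->.
  by apply: eq_card => c; rewrite !inE finset.set0U andb_idr//; exact: QB.
have /card_gt0P[e eA] : (0 < #|A|)%N by rewrite cA.
have cA' : #|(A :\ e)| = m by move: cA; rewrite (cardsD1 e) eA => -[].
have dA' : [disjoint A :\ e & B].
  by apply: disjointWl dAB; exact: subsetDl.
have eB : e \notin B by rewrite (disjointFr dAB eA).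
have eAB : e \notin (A :\ e :|: B) by rewrite !inE eqxx.
have QA' f c x : f \in (A :\ e) -> Q (recolor c f x) = Q c.
  by move=> /setD1P[_]; exact: QA.
have := IHm _ cA' dA' QA' QB; rewrite cA' cA => IH.
pose Q' := [pred c | Q c && dinjectiveb c (A :\ e :|: B)].
have Q'e c x : Q' (recolor c e x) = Q' c.
  by rewrite /Q'/= QA// dinjectiveb_recolor.
have Q'D c : Q' c -> dinjectiveb c (A :\ e :|: B) by move=> /andP[].
have := card_dinjectiveU1 Q' _ e eAB Q'e Q'D.
rewrite cardsU finset.disjoint_setI0// cards0 subn0 cA' finset.setUA finset.setD1K// => step.
(* Injectivity on the larger set implies it on the smaller one, so [Q] may be replaced by [Q'] and
   the one-element step applies. *)
have -> : #|[pred c | Q c && dinjectiveb c (A :|: B)]| =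
          #|[pred c | Q' c && dinjectiveb c (A :|: B)]|.
  apply: eq_card => c; rewrite !inE -andbA; congr andb.
  apply/idP/andP => [/dinjectiveP inj|[]//]; split; last exact/dinjectiveP.
  by apply/dinjectiveP; apply: sub_in2 inj => y; rewrite !inE => /orP[/andP[_ ->]|->]; rewrite ?orbT.
rewrite ffactnSr expnS mulnA step -mulnA [(_ * #|C| ^ m)%N]mulnC mulnA.
by rewrite IH -mulnA -subnDA addnC.
Qed.

(** * Fixed points of permutations and the mean of [ffact_excess] *)

Lemma expR_partial_sum_ge {R : realType} (x : R) (n : nat) : 0 <= x ->
  \sum_(k < n) x ^+ k / k`!%:R <= expR x.
Proof.
move=> x0; rewrite -(big_mkord xpredT (fun k => x ^+ k / k`!%:R)).
apply: (nondecreasing_cvgn_le _ (is_cvg_series_exp_coeff x)) => //.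
by apply: nondecreasing_series => k _ _; exact: exp_coeff_ge0.
Qed.

Definition agreements {n : nat} (u v : 'S_n) : {set 'I_n} := [set i | u i == v i].

(** Union bound: such a permutation fixes some [j]-set [A] pointwise, and each [A] is fixed by
    [(n - j)!] permutations. The product ['C(n, j) * (n - j)!] is [n! / j!] for [j <= n] and 0
    beyond. *)
Lemma card_perm_agreements_ge (n j : nat) :
  (#|[set u : 'S_n | (j <= #|agreements 1%g u|)%N]| * j`! <= n`!)%N.
Proof.
have E (u : 'S_n) (A : {set 'I_n}) :
    (A \subset agreements 1%g u) = perm_on (~: A) u.
  apply/fintype.subsetP/fintype.subsetP => sub i.
    rewrite !inE; apply: contra => /sub.
    by rewrite inE perm1 => /eqP <-.
  move=> iA; rewrite inE perm1 eq_sym; apply: contraTT iA => iu.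
  by move: (sub i iu); rewrite inE.
have le : (#|[set u : 'S_n | (j <= #|agreements 1%g u|)%N]| <=
    'C(n, j) * (n - j)`!)%N.
  rewrite -[in 'C(n, j)](card_ord n) -card_draws -sum_nat_const.
  rewrite -sum1_card.
  apply: (@leq_trans (\sum_(u : 'S_n)
      \sum_(A in [set A : {set 'I_n} | #|A| == j]) perm_on (~: A) u)%N).
    rewrite big_mkcond/=; apply: leq_sum => u _; rewrite inE.
    case: ifPn => // ju; rewrite -big_mkcondr/= sum1_card.
    (* The fixed-point set has at least [j] elements, hence at least one [j]-subset, so [u] is
       counted at least once. *)
    rewrite -bin_gt0 -cards_draws in ju.
    rewrite (leq_trans ju)// subset_leq_card//; apply/fintype.subsetP => A.
    by rewrite !inE -topredE/= inE -E andbC => ->.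
  rewrite exchange_big/=; apply: leq_sum => A; rewrite inE => /eqP cA.
  by rewrite -big_mkcond/= sum1_card card_perm cardsCs finset.setCK cA card_ord.
have [jn|nj] := leqP j n.
  by rewrite (leq_trans (leq_mul le (leqnn _)))// -mulnA [((n - j)`! * _)%N]mulnC bin_fact.
by move: le; rewrite bin_small// mul0n leqn0 => /eqP ->; rewrite mul0n.
Qed.

(** Factor by factor, [s * (j - i) <= (s - i) * j], since [i * j <= s * i]. *)
Lemma expn_ffact_le (s j m : nat) : (j <= s)%N ->
  (s ^ m * j ^_ m <= s ^_ m * j ^ m)%N.
Proof.
move=> js; elim: m => [|m IHm]; first by rewrite !ffactn0.
rewrite !ffactnSr !expnSr mulnACA [leqRHS]mulnACA leq_mul//.
by rewrite mulnBr mulnBl leq_sub2l// mulnC leq_mul2r js orbT.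
Qed.

(** The function g of the overview: the factor by which [k] shared edges raise the joint probability
    above the product of the two. For [k > s] the division by zero gives 0; all estimates below stay
    in the range [k <= s]. *)
Definition ffact_excess (R : realType) (s k : nat) : R :=
  s%:R ^+ k / (s ^_ k)%:R.

Lemma ffact_excess0 (R : realType) (s : nat) : ffact_excess R s 0 = 1.
Proof. by rewrite /ffact_excess ffactn0 expr0 divr1. Qed.

Lemma ffact_excess_le_expR (R : realType) (s j : nat) : (j <= s)%N ->
  ffact_excess R s j <= expR 1 ^+ j.
Proof.
move=> js; rewrite -expRM_natl mulr1; case: j js => [|j] js.
  by rewrite ffact_excess0 expR0.
have j0 : 0 <= j.+1%:R :> R by [].
(* Each factor s / (s - i) is at most (j + 1) / (j + 1 - i). *)
apply: (@le_trans _ _ (j.+1%:R ^+ j.+1 / j.+1`!%:R)); last first.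
  (* The quotient is a single term of the exponential series at [j + 1]. *)
  by apply: le_trans (expR_ge1Dxn j j0); rewrite lerDr.
rewrite /ffact_excess ler_pdivrMr ?ltr0n ?ffact_gt0// mulrAC.
rewrite ler_pdivlMr ?ltr0n ?fact_gt0// -!natrX -!natrM ler_nat.
by rewrite -ffactnn [leqRHS]mulnC expn_ffact_le.
Qed.

Lemma ffact_excessS (R : realType) (s j : nat) : (j < s)%N ->
  ffact_excess R s j.+1 - ffact_excess R s j =
  ffact_excess R s j.+1 * (j%:R / s%:R).
Proof.
move=> js; rewrite /ffact_excess ffactnSr natrM natrB 1?ltnW// exprSr.
have s0 : s%:R != 0 :> R by rewrite pnatr_eq0 -lt0n (leq_ltn_trans _ js).
have f0 : (s ^_ j)%:R != 0 :> R by rewrite pnatr_eq0 -lt0n ffact_gt0 ltnW.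
have sj0 : s%:R - j%:R != 0 :> R by rewrite subr_eq0 eqr_nat gtn_eqF.
by field; rewrite s0 f0 sj0.
Qed.

(** The increments are summed up to the fixed bound [n] with indicators [j < k], so that this sum
    can be exchanged with the sum over permutations. *)
Lemma ffact_excess_telescope (R : realType) (n s k : nat) :
  (n <= s)%N -> (k <= n)%N ->
  ffact_excess R s k = 1 + \sum_(j < n)
    (j < k)%N%:R * (ffact_excess R s j.+1 * (j%:R / s%:R)).
Proof.
move=> ns kn; rewrite -(big_mkord xpredT (fun j =>
  (j < k)%N%:R * (ffact_excess R s j.+1 * (j%:R / s%:R)))).
rewrite (big_cat_nat (n := k))//= [X in 1 + (_ + X)]big_nat_cond.
rewrite [X in 1 + (_ + X)]big1 ?addr0; last first.
  by move=> j /andP[/andP[kj _] _]; rewrite ltnNge kj mul0r.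
rewrite (eq_big_nat _ _ (F2 := fun j => ffact_excess R s j.+1 - ffact_excess R s j)).
  by rewrite telescope_sumr// ffact_excess0 addrC subrK.
move=> j /andP[_ jk]; rewrite jk mul1r ffact_excessS//.
by rewrite (leq_trans jk)// (leq_trans kn).
Qed.

Lemma sum_ffact_excess_agreements (R : realType) (n s : nat) :
  (0 < n)%N -> (n <= s)%N ->
  \sum_(u : 'S_n) ffact_excess R s #|agreements 1%g u| <=
  n`!%:R * (1 + expR 1 * expR (expR 1) / n%:R).
Proof.
move=> n0 ns.
have -> : \sum_(u : 'S_n) ffact_excess R s #|agreements 1%g u| =
    \sum_(u : 'S_n) (1 + \sum_(j < n) (j < #|agreements 1%g u|)%N%:R *
      (ffact_excess R s j.+1 * (j%:R / s%:R))).
  apply: eq_bigr => u _; apply: ffact_excess_telescope => //.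
  by rewrite -[leqRHS]card_ord max_card.
rewrite big_split/= sumr_const card_Sn.
rewrite exchange_big/= mulrDr mulr1 lerD2l.
have e0 : 0 < expR 1 :> R by exact: expR_gt0.
(* With this termwise bound, the remaining sum is a partial sum of the exponential series at e,
   which yields the constant [expR (expR 1)]. *)
apply: (@le_trans _ _ (\sum_(j < n)
    n`!%:R * (expR 1 / n%:R) * (expR 1 ^+ j / j`!%:R))); last first.
  rewrite -big_distrr/= -mulrA ler_pM2l ?ltr0n ?fact_gt0// [leRHS]mulrAC.
  by rewrite ler_pM2l ?divr_gt0 ?ltr0n// expR_partial_sum_ge// ltW.
apply: ler_sum => j _; rewrite -big_distrl/= -natr_sum.
set c := (\sum_(u : 'S_n) _)%N.
have cle : c%:R <= n`!%:R / j.+1`!%:R :> R.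
  rewrite ler_pdivlMr ?ltr0n ?fact_gt0// -natrM ler_nat.
  apply: leq_trans (card_perm_agreements_ge n j.+1).
  rewrite leq_mul2r -sum1_card [leqRHS]big_mkcond/=; apply/orP; right.
  apply: leq_sum => u _. by rewrite inE; case: ltnP.
have jn : (j < s)%N by exact: leq_trans (ltn_ord j) ns.
have gle := ffact_excess_le_expR R s j.+1 jn.
(* Here [s] leaves the estimate, which becomes uniform in [s >= n]. *)
have jle : j%:R / s%:R <= j%:R / n%:R :> R.
  by rewrite ler_wpM2l// lef_pV2 ?posrE ?ltr0n ?ler_nat// (leq_trans n0).
apply: (@le_trans _ _ (n`!%:R / j.+1`!%:R * (expR 1 ^+ j.+1 * (j%:R / n%:R)))).
  have g0 : 0 <= ffact_excess R s j.+1 by rewrite divr_ge0 ?exprn_ge0.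
  have d0 : 0 <= j%:R / s%:R :> R by rewrite divr_ge0.
  by apply: ler_pM => //; [exact: mulr_ge0 | exact: ler_pM].
rewrite factS natrM exprS.
have f0 : j`!%:R != 0 :> R by rewrite pnatr_eq0 -lt0n fact_gt0.
have n00 : n%:R != 0 :> R by rewrite pnatr_eq0 -lt0n.
(* The factor [j + 1] of [(j + 1)!] is set against [j]; their quotient is at most 1 and is
   dropped. *)
have -> : n`!%:R / (j.+1%:R * j`!%:R) * (expR 1 * expR 1 ^+ j * (j%:R / n%:R)) =
  n`!%:R * (expR 1 / n%:R) * (expR 1 ^+ j / j`!%:R) * (j%:R / j.+1%:R) :> R.
  by field; rewrite f0 n00 /= addrC natr1 pnatr_eq0.
rewrite ler_piMr ?mulr_ge0 ?divr_ge0 ?exprn_ge0 ?(ltW e0)//.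
by rewrite ler_pdivrMr// mul1r ler_nat.
Qed.

(** * Permutation graphs as perfect matchings, and their rainbow probabilities *)

Definition graph {n : nat} (u : 'S_n) : {set edge n} :=
  [set ((i, u i) : edge n) | i in 'I_n].

Lemma mem_graph {n : nat} (u : 'S_n) (e : edge n) :
  (e \in graph u) = (e.2 == u e.1).
Proof.
apply/imsetP/eqP => [[i _ ->]//|ue].
by exists e.1 => //; rewrite -ue; case: e {ue}.
Qed.

Lemma card_graph {n : nat} (u : 'S_n) : #|graph u| = n.
Proof. by rewrite card_imset ?card_ord// => i j []. Qed.

Lemma card_graphI {n : nat} (u v : 'S_n) :
  #|graph u :&: graph v| = #|agreements u v|.
Proof.
have inj : injective (fun i : 'I_n => (i, u i) : edge n) by move=> i j [].
rewrite -(card_imset _ inj); apply: eq_card => e; rewrite inE !mem_graph.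
apply/andP/imsetP => [[/eqP eu /eqP ev]|[i + ->]].
  by exists e.1; [rewrite inE -eu ev | rewrite -eu; case: e {eu ev}].
by rewrite inE /= => ->.
Qed.

Lemma perfect_matching_graph {n : nat} (u : 'S_n) : perfect_matching (graph u).
Proof.
apply/forallP => -[i|j]; apply/cards1P.
  exists (i, u i); apply/setP => -[a b]; rewrite !inE mem_graph/= xpair_eqE andbC.
  by case: (a =P i) => // ->.
exists ((u^-1)%g j, j); apply/setP => -[a b]; rewrite !inE mem_graph/= xpair_eqE andbC.
case: (b =P j) => [->|]; rewrite ?andbF ?andbT//=.
by rewrite -[RHS](inj_eq (@perm_inj _ u)) permKV eq_sym.
Qed.

Lemma rainbow_graph {n s : nat} (c : coloring n s) (u : 'S_n) :
  dinjectiveb c (graph u) -> has_rainbow_perfect_matching c.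
Proof.
move=> /dinjectiveP inj; apply/existsP; exists (graph u).
rewrite perfect_matching_graph; apply/forall_inP => e eu; apply/forall_inP => f fu.
by apply/implyP; apply: contraNneq => /inj ->.
Qed.

Lemma card_rainbow_graph {R : realType} {n s : nat} (u : 'S_n) :
  (0 < s)%N ->
  #|[pred c : coloring n s | dinjectiveb c (graph u)]|%:R =
  #|coloring n s|%:R * ((s ^_ n)%:R / s%:R ^+ n) :> R.
Proof.
move=> s0; have sn0 : s%:R ^+ n != 0 :> R by rewrite expf_neq0// pnatr_eq0 -lt0n.
apply: (mulIf sn0); rewrite -mulrA divfK// -natrX -!natrM.
have := @card_dinjectiveU _ 'I_s predT (graph u) finset.set0.
rewrite finset.setU0 cards0 subn0 card_graph card_ord => <-//.
  by rewrite -setI_eq0 finset.setI0.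
by move=> c _; apply/dinjectiveP => e; rewrite inE.
Qed.

Lemma ffactD (s k m : nat) : (s ^_ (k + m) = s ^_ k * (s - k) ^_ m)%N.
Proof.
elim: m => [|m IHm]; first by rewrite addn0 ffactn0 muln1.
by rewrite addnS !ffactnSr IHm mulnA subnDA.
Qed.

Lemma card_rainbow_graph2 {R : realType} {n s : nat} (u v : 'S_n) :
  (0 < s)%N -> (n <= s)%N ->
  #|[pred c : coloring n s | dinjectiveb c (graph u) && dinjectiveb c (graph v)]|%:R =
  #|coloring n s|%:R * ((s ^_ n)%:R / s%:R ^+ n) ^+ 2 *
    ffact_excess R s #|agreements u v| :> R.
Proof.
move=> s0 ns; set k := #|agreements u v|.
have kn : (k <= n)%N by rewrite -[leqRHS](card_ord n) max_card.
have sX m : s%:R ^+ m != 0 :> R by rewrite expf_neq0// pnatr_eq0 -lt0n.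
(* The shared edges have distinct colors once the graph of [u] is rainbow; only the [n - k] edges
   private to the graph of [v] are recolored. *)
have := @card_dinjectiveU _ 'I_s (fun c => dinjectiveb c (graph u))
  (graph v :\: graph u) (graph v :&: graph u).
rewrite finset.setUC finset.setID cardsD [graph v :&: _]finset.setIC card_graphI.
rewrite card_graph card_ord -/k => H.
have f0 : (s ^_ k)%:R != 0 :> R.
  by rewrite pnatr_eq0 -lt0n ffact_gt0 (leq_trans kn).
apply: (mulIf (sX (n - k)%N)); rewrite -natrX -natrM H; first last.
- move=> c /dinjectiveP inj; apply/dinjectiveP.
  by apply: sub_in2 inj => e; rewrite inE => /andP[].
- by move=> e c x; rewrite inE => /andP[eu _]; rewrite dinjectiveb_recolor.
- rewrite -setI_eq0; apply/eqP/setP => e.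
  by rewrite !inE; case: (e \in graph u); rewrite ?andbF.
rewrite natrM card_rainbow_graph// /ffact_excess natrX.
have -> : (s ^_ n)%:R = (s ^_ k)%:R * ((s - k) ^_ (n - k))%:R :> R.
  by rewrite -natrM -ffactD subnKC.
have -> : s%:R ^+ n = s%:R ^+ k * s%:R ^+ (n - k) :> R.
  by rewrite -exprD subnKC.
by field; rewrite f0 !sX.
Qed.

(** * Chebyshev's inequality and the lower bound on the probability *)

(** Every zero of [X] contributes [m ^+ 2] to the sum of [(X c - m) ^+ 2], and expanding this sum
    around the mean [m] gives the right-hand side. *)
Lemma second_moment_zeros {R : realFieldType} {T : finType} (X : T -> R) (m : R) :
  \sum_c X c = #|T|%:R * m ->
  #|[pred c | X c == 0]|%:R * m ^+ 2 <= \sum_c X c ^+ 2 - #|T|%:R * m ^+ 2.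
Proof.
move=> EX; apply: (@le_trans _ _ (\sum_c (X c - m) ^+ 2)).
  rewrite -sum1_card natr_sum big_distrl/= big_mkcond/=.
  apply: ler_sum => c _; rewrite inE; case: eqP => [->|_]; last exact: sqr_ge0.
  by rewrite mul1r sub0r sqrrN.
have sqE c : (X c - m) ^+ 2 = X c ^+ 2 + (m ^+ 2 - 2 * m * X c) by ring.
under eq_bigr do rewrite sqE.
rewrite big_split/= sumrB sumr_const -big_distrr/= EX -mulr_natl lerD2l.
by rewrite le_eqVlt; apply/orP; left; apply/eqP; ring.
Qed.

Lemma URM_card (R : realType) (n s : nat) (A : {set coloring n s}) :
  URM R A = #|A|%:R / #|coloring n s|%:R.
Proof.
by rewrite /URM /uniform_color prodr_const sumr_const card_ffun card_ord natrX
  exprVn mulr_natl.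
Qed.

(** Since [u] is injective, agreement of [u] with [v] followed by [u] means a fixed point of [v].
    Reindexing thus makes all rows of the double sum over pairs equal to the row of the identity. *)
Lemma agreements_mulg {n : nat} (u v : 'S_n) :
  agreements u (v * u)%g = agreements 1%g v.
Proof.
by apply/setP => i; rewrite !inE permM perm1 (inj_eq (@perm_inj _ u)).
Qed.

Lemma URM_has_rainbow_ge (R : realType) (n s : nat) :
  (0 < n)%N -> (n <= s)%N ->
  1 - expR 1 * expR (expR 1) / n%:R <=
  URM R [set c : coloring n s | has_rainbow_perfect_matching c].
Proof.
move=> n0 ns; have s0 : (0 < s)%N := leq_trans n0 ns.
set C := expR 1 * expR (expR 1).
pose T : finType := coloring n s; pose N : R := #|T|%:R.
have N0 : 0 < N by rewrite ltr0n card_ffun card_ord expn_gt0 s0.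
pose p : R := (s ^_ n)%:R / s%:R ^+ n; pose m := n`!%:R * p.
have m0 : 0 < m.
  by rewrite mulr_gt0 ?divr_gt0 ?exprn_gt0 ?ltr0n ?fact_gt0 ?ffact_gt0.
pose I (u : 'S_n) (c : T) := dinjectiveb c (graph u).
pose X (c : T) : R := \sum_(u : 'S_n) (I u c)%:R.
have sumE (P : pred T) : \sum_c (P c)%:R = #|P|%:R :> R.
  rewrite -sum1_card natr_sum [RHS]big_mkcond; apply: eq_bigr => c _.
  by rewrite unfold_in; case: (P c).
have EX : \sum_c X c = N * m.
  rewrite exchange_big/=.
  under eq_bigr do rewrite sumE card_rainbow_graph//.
  by rewrite sumr_const card_Sn -[LHS]mulr_natl mulrCA.
have EX2 : \sum_c X c ^+ 2 <= N * m ^+ 2 * (1 + C / n%:R).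
  have -> : \sum_c X c ^+ 2 = \sum_(u : 'S_n) \sum_(v : 'S_n)
      N * p ^+ 2 * ffact_excess R s #|agreements u v|.
    under eq_bigr do rewrite expr2 big_distrlr/=.
    rewrite exchange_big/=; apply: eq_bigr => u _.
    rewrite exchange_big/=; apply: eq_bigr => v _.
    rewrite -card_rainbow_graph2// -sumE.
    by apply: eq_bigr => c _; rewrite -natrM mulnb.
  have -> : \sum_(u : 'S_n) \sum_(v : 'S_n)
      N * p ^+ 2 * ffact_excess R s #|agreements u v| =
      n`!%:R * (N * p ^+ 2 *
        \sum_(v : 'S_n) ffact_excess R s #|agreements 1%g v|).
    rewrite mulr_natl -card_Sn -sumr_const; apply: eq_bigr => u _.
    rewrite -big_distrr/= (reindex_inj (mulIg u))/=; congr (_ * _).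
    by apply: eq_bigr => v _; rewrite agreements_mulg.
  have -> : N * m ^+ 2 * (1 + C / n%:R) =
      n`!%:R * (N * p ^+ 2 * (n`!%:R * (1 + C / n%:R))) by rewrite /m; ring.
  have Np0 : 0 <= N * p ^+ 2 by rewrite mulr_ge0 ?sqr_ge0 ?(ltW N0).
  rewrite ler_wpM2l// ler_wpM2l//.
  exact: sum_ffact_excess_agreements.
set A := [set c | _]; rewrite URM_card -/N ler_pdivlMr//.
have zeros : #|~: A|%:R <= N * (C / n%:R).
  have m20 : 0 < m ^+ 2 by rewrite exprn_gt0.
  rewrite -(ler_pM2r m20).
  (* A coloring outside [A] has no rainbow permutation graph, so [X] vanishes there. *)
  apply: (@le_trans _ _ (#|[pred c | X c == 0]|%:R * m ^+ 2)).
    rewrite ler_pM2r// ler_nat subset_leq_card//; apply/fintype.subsetP => c.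
    rewrite !inE => /negP bad; rewrite /X big1// => u _.
    by rewrite /I; case: (boolP (dinjectiveb _ _)) => // /rainbow_graph.
  apply: le_trans (second_moment_zeros _ _ EX) _; move: EX2.
  by rewrite -/N; lra.
have : #|A|%:R + #|~: A|%:R = N by rewrite -natrD cardsC.
move: zeros; lra.
Qed.

(** * Passage to the limit *)

Local Open Scope classical_set_scope.

Theorem theorem5 (R : realType) (s : nat -> nat)
    (s_ge : forall n : nat, (n <= s n)%N) :
  (fun n : nat =>
     URM R [set c : coloring n (s n) | has_rainbow_perfect_matching c]%SET)
    @ \oo --> (1 : R).
Proof.
pose C : R := expR 1 * expR (expR 1).
rewrite -cvg_shiftS; apply: (@squeeze_cvgr _ _ _ _ (fun n => 1 - C * harmonic n) (cst 1)).
- near=> n; rewrite URM_has_rainbow_ge//= URM_card.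
  rewrite ler_pdivrMr ?mul1r ?ler_nat ?max_card//.
  by rewrite ltr0n card_ffun card_ord expn_gt0 (leq_trans _ (s_ge _)).
- rewrite -[X in _ --> X]subr0 -[X in _ - X](mulr0 C).
  by apply: cvgB; [exact: cvg_cst | apply: cvgM; [exact: cvg_cst | exact: cvg_harmonic]].
- exact: cvg_cst.
Unshelve. all: by end_near.
Qed.
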